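(* Let $X$ be a real Banach space that is smooth and uniformly convex and whose duality mapping $J_p:X\to X^*$ is sequentially weak-to-weak continuous, let $Y$ be an arbitrary real Banach space, let $A:X\to Y$ be bounded linear, let $y\in\mathcal{R}(A)$ and $M=\{x\in X: Ax=y\}$. Run the SESOP method with semi-orthogonalized truncated search spaces described in the context. Then either the method stops after finitely many steps $n$ (i.e. $R_n=\|Ax_n-y\|_Y=0$), in which case $x_n$ equals the Bregman projection $\Pi_M(x_0)$ of $x_0$ onto $M$, or the sequence of iterates $(x_n)_n$ converges weakly to $\Pi_M(x_0)$.
   Context: Fix $p,r\in(1,\infty)$ and $p^*=p/(p-1)$. $J_p:X\to X^*$ is the (single-valued, since $X$ is smooth) duality mapping with gauge $t\mapsto t^{p-1}$: $J_p(x)$ is the element $x^*$ with $\langle x^*,x\rangle=\|x\|^p$ and $\|x^*\|=\|x\|^{p-1}$; equivalently $J_p$ is the derivative of $\tfrac1p\|\cdot\|^p$. $J_{p^*}:X^*\to X$ is the duality mapping of $X^*$ with gauge $t^{p^*-1}$ (the inverse of $J_p$). $J_r^Y:Y\to Y^*$ is a fixed single-valued selection of the duality mapping of $Y$ with gauge $t^{r-1}$, so $\langle J_r^Y(w),w\rangle=\|w\|^r$, $\|J_r^Y(w)\|=\|w\|^{r-1}$. The Bregman distance is $D_p(x,z)=\tfrac1{p^*}\|x\|^p-\langle J_p(x),z\rangle+\tfrac1p\|z\|^p$, and the Bregman projection $\Pi_C(x)$ of $x$ onto a closed convex nonempty $C\subset X$ is the unique minimizer of $z\mapsto D_p(x,z)$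 over $z\in C$. $A^*:Y^*\to X^*$ is the adjoint. Method: choose $x_0$ with $J_p(x_0)\in\overline{\mathcal{R}(A^* )}$, fix $N\in\mathbb{N}$, and set $N_n=\min(N,n+1)$. For $n=0,1,\dots$: let $w_n=Ax_n-y$, $R_n=\|w_n\|$; if $R_n=0$, stop. Otherwise let $u_n^*=J_r^Y(w_n)\in Y^*$ and $u_n=A^*u_n^*$ (Landweber descent direction). Let $s_n=(s_{n,1},\dots,s_{n,N_{n-1}})$ minimize $s\mapsto\|u_n-\sum_{i=1}^{N_{n-1}}s_iv_{n-1,i}\|_{X^*}^{p^*}$ (for $n=0$ the sum is empty). Define the new direction $v_{n,N_n}=u_n-\sum_{k=1}^{N_{n-1}}s_{n,k}v_{n-1,k}$ with precursor $w^*_{n,N_n}=u_n^*-\sum_k s_{n,k}w^*_{n-1,k}$ (so $v_{n,N_n}=A^*w^*_{n,N_n}$); the remaining directions $v_{n,1},\dots,v_{n,N_n-1}$ (and their precursors) are the last $N_n-1$ entries of the previous list $v_{n-1,1},\dots,v_{n-1,N_{n-1}}$, kept in order. Set offsets $\beta_{n,k}=\langle w^*_{n,k},y\rangle$ and $V_n=\mathrm{span}\{v_{n,1},\dots,v_{n,N_n}\}$. Let $t_n$ minimize $h_n(t)=\tfrac1{p^*}\|J_p(x_n)-\sum_{k=1}^{N_n}t_kv_{n,k}\|_{X^*}^{p^*}+\sum_{k=1}^{N_n}t_k\beta_{n,k}$ over $t\in\mathbb{R}^{N_n}$ and set $x_{n+1}=J_{p^*}\big(J_p(x_n)-\sum_{k=1}^{N_n}t_{n,k}v_{n,k}\big)$.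 *)

(* Defs.v *)
From HB Require Import structures.
From mathcomp Require Import all_boot all_order all_algebra.
From mathcomp Require Import all_classical all_reals all_analysis.
Set Implicit Arguments. Unset Strict Implicit. Unset Printing Implicit Defensive.
Import Order.TTheory GRing.Theory Num.Theory.
Import numFieldNormedType.Exports.
Local Open Scope classical_set_scope.
Local Open Scope ring_scope.

Section Defs.
Variable R : realType.

Definition islin (V W : normedModType R) (f : V -> W) : Prop :=
  forall (a : R) (u v : V), f (a *: u + v) = a *: f u + f v.

Definition isDual (V : normedModType R) (f : V -> R) : Prop :=
  @islin V R^o f /\ continuous f.

Definition dnorm (V : normedModType R) (f : V -> R) : R :=
  sup [set `|f v| | v in [set v : V | `|v| <= 1]].

Definition weak_cvg (V : normedModType R) (u : nat -> V) (l : V) : Prop :=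
  forall f : V -> R, isDual f -> (fun n => f (u n)) @ \oo --> f l.

Definition isBidual (V : normedModType R) (Phi : (V -> R) -> R) : Prop :=
  (forall (a : R) (f g : V -> R), isDual f -> isDual g ->
     Phi (fun v => a * f v + g v) = a * Phi f + Phi g) /\
  exists C : R, forall f : V -> R, isDual f -> `|Phi f| <= C * dnorm f.

Definition weak_cvg_dual (V : normedModType R) (u : nat -> V -> R) (l : V -> R) : Prop :=
  forall Phi : (V -> R) -> R, isBidual Phi -> (fun n => Phi (u n)) @ \oo --> Phi l.

Definition smooth_space (V : normedModType R) : Prop :=
  forall x : V, x <> 0 ->
    exists f : V -> R, (isDual f /\ dnorm f = 1 /\ f x = `|x|) /\
      forall g : V -> R, isDual g -> dnorm g = 1 -> g x = `|x| -> g = f.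

Definition unif_convex (V : normedModType R) : Prop :=
  forall eps : R, 0 < eps <= 2 -> exists delta : R, 0 < delta /\
    forall x y : V, `|x| <= 1 -> `|y| <= 1 -> eps <= `|x - y| ->
      `|(2^-1) *: (x + y)| <= 1 - delta.

(* J is (a selection of) the duality mapping of V with gauge t |-> t^(q-1). *)
Definition duality_map (V : normedModType R) (q : R) (J : V -> V -> R) : Prop :=
  forall x : V, isDual (J x) /\ J x x = `|x| `^ q /\ dnorm (J x) = `|x| `^ (q - 1).

Definition bregman (V : normedModType R) (p : R) (J : V -> V -> R) (x z : V) : R :=
  (p / (p - 1))^-1 * `|x| `^ p - J x z + p^-1 * `|z| `^ p.

Definition is_bregman_proj (V : normedModType R) (p : R) (J : V -> V -> R)
  (C : set V) (x z : V) : Prop :=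
  C z /\ forall z', C z' -> bregman p J x z <= bregman p J x z'.

(* Number of search directions N_n = min(N, n+1) and N_{n-1} (= 0 for n = 0). *)
Definition Nn (N n : nat) : nat := minn N n.+1.
Definition Nprev (N n : nat) : nat := minn N n.

(* A run of the SESOP method with semi-orthogonalized truncated search spaces.
   Directions are 0-indexed: v_{n,k+1} in the paper is [wst n k \o A] here,
   with precursors [wst n k] in Y^*.  The constraints at step n are imposed
   as long as the method has not stopped at steps 0..n. *)
Definition sesop_run (X Y : normedModType R) (p r : R) (N : nat)
  (Jp : X -> X -> R) (JrY : Y -> Y -> R) (A : X -> Y) (y : Y)
  (x : nat -> X) (wst : nat -> nat -> Y -> R)
  (s : nat -> nat -> R) (t : nat -> nat -> R) : Prop :=
  let ps := p / (p - 1) in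
  forall n : nat, (forall m, (m <= n)%N -> `|A (x m) - y| <> 0) ->
    let ust := JrY (A (x n) - y) in
    let u := fun z => ust (A z) in
    (forall s' : nat -> R,
       dnorm (fun z => u z - \sum_(i < Nprev N n) s n i * wst n.-1 i (A z)) `^ ps
       <= dnorm (fun z => u z - \sum_(i < Nprev N n) s' i * wst n.-1 i (A z)) `^ ps) /\
    wst n (Nn N n).-1 = (fun w => ust w - \sum_(i < Nprev N n) s n i * wst n.-1 i w) /\
    (* kept directions: the last N_n - 1 entries of the previous list *)
    (forall k, (k < (Nn N n).-1)%N ->
       wst n k = wst n.-1 (k + Nprev N n + 1 - Nn N n)%N) /\
    (forall t' : nat -> R,
       ps^-1 * dnorm (fun z => Jp (x n) z - \sum_(k < Nn N n) t n k * wst n k (A z)) `^ ps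
         + \sum_(k < Nn N n) t n k * wst n k y
       <= ps^-1 * dnorm (fun z => Jp (x n) z - \sum_(k < Nn N n) t' k * wst n k (A z)) `^ ps
         + \sum_(k < Nn N n) t' k * wst n k y) /\
    (* x_{n+1} = J_{p*}(J_p(x_n) - sum_k t_{n,k} v_{n,k}), i.e. J_p(x_{n+1}) = ... *)
    Jp (x n.+1) = (fun z => Jp (x n) z - \sum_(k < Nn N n) t n k * wst n k (A z)).

End Defs.

(* Main.v *)
Require Import Defs.
From HB Require Import structures.
From mathcomp Require Import all_boot all_order all_algebra.
From mathcomp Require Import all_classical all_reals all_analysis.
From mathcomp Require Import ring lra zify.
Import Order.TTheory GRing.Theory Num.Theory.
Import numFieldNormedType.Exports.
Local Open Scope classical_set_scope.
Local Open Scope ring_scope.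

(** The step minimization makes x_(n+1) satisfy all constraints
    <w*_(n,k), A x - y> = 0 of step n, so the semi-orthogonalized direction of
    step n+1 pairs with the new residual exactly as the plain Landweber
    direction does, and its norm is no larger.  Uniform convexity of X makes
    the conjugate norm power uniformly smooth at the points J_p(x), whence a
    decrease of D_p(x_n, z) at least proportional to the residual up to an
    arbitrarily small error; hence R_n -> 0 and (x_n) is bounded.  Every
    J_p(x_n) annihilates N(A), a property passed on to weak cluster points by
    the weak continuity of J_p, and a solution l with J_p(l) annihilating N(A)
    is the Bregman projection of x_0 and is unique.

    Weak sequential compactness of bounded sequences is derived from uniform
    convexity without duality theory: an ultrafilter limit is found among
    almost minimal elements of convex hulls, and a countable family of
    functionals J_p(d) suffices to extract a sequence. *)

Set Implicit Arguments. Unset Strict Implicit. Unset Printing Implicit Defensive.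

(** * Inequalities for real powers *)

Section RealPowers.
Variable R : realType.
Implicit Types p q a b t d eps : R.

Lemma bernoulli_powR_lt p t : 1 < p -> 0 <= t -> t != 1 ->
  1 + p * (t - 1) < t `^ p.
Proof.
move=> p1; rewrite le_eqVlt => /predU1P[<- _|t0 t1].
  by rewrite powR0; [lra|apply/eqP; lra].
(* Strict weighted AM-GM for [t `^ p] and [1], whose geometric mean is [t]. *)
have cN0 : ln t != 0 by rewrite ln_eq0.
have tE : expR (ln t) = t by rewrite lnK.
have powE : t `^ p = t * expR ((p - 1) * ln t).
  rewrite -{2}tE -expRD /powR gt_eqF//; congr expR; ring.
have inv : 1 = t * expR (- ln t) by rewrite expRN tE divff// gt_eqF.
have e1 : 1 + (p - 1) * ln t < expR ((p - 1) * ln t).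
  by apply: expR_gt1Dx; rewrite mulf_neq0//; apply/eqP; lra.
have e2 : 1 - ln t < expR (- ln t) by apply: expR_gt1Dx; rewrite oppr_eq0.
have e3 : (p - 1) * (1 - ln t) < (p - 1) * expR (- ln t).
  by rewrite ltr_pM2l//; lra.
have : t * p < t * (expR ((p - 1) * ln t) + (p - 1) * expR (- ln t)).
  by rewrite ltr_pM2l//; lra.
rewrite mulrDr -powE mulrCA -inv; lra.
Qed.

Lemma bernoulli_powR p t : 1 < p -> 0 <= t -> 1 + p * (t - 1) <= t `^ p.
Proof.
move=> p1 t0; have [->|t1] := eqVneq t 1; first by rewrite powR1; lra.
exact/ltW/bernoulli_powR_lt.
Qed.

(** Here [a] and [b] stand for two norms and [c] for the norm of the midpoint. If [a] and [b] are
    far apart, strict convexity of the power gives the gap; if they are close, the bound by [1 - d]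
    times the maximum puts [c] well below their mean. *)
Lemma powR_midpoint_gap p d : 1 < p -> 0 < d -> exists2 k, 0 < k &
  forall a b c, 0 <= a -> 0 <= b -> 0 <= c ->
    c <= (a + b) / 2 -> c <= (1 - d) * Num.max a b ->
    k * (Num.max a b) `^ p <= (a `^ p + b `^ p) / 2 - c `^ p.
Proof.
move=> p1 d0.
(* Shrinking [d] only weakens the assumption on [c], and [d < 1] keeps the base [1 - d] positive. *)
wlog d1 : d d0 / d < 1.
  move=> H; have [k k0 Hk] := H (Num.min d 2^-1) ltac:(by rewrite lt_min d0; lra)
    ltac:(by rewrite gt_min; apply/orP; right; lra).
  exists k => // a b c a0 b0 c0 cab cd; apply: Hk => //; apply: (le_trans cd).
  apply: ler_wpM2r; first by rewrite le_max a0.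
  by rewrite lerD2l lerN2 ge_min lexx.
(* After scaling the maximum to 1, the mean is compared with [m0], halfway between [1 - d] and 1.
   [B] is the excess of the power over its tangent at 1. *)
pose m0 := 1 - d / 2; have m00 : 0 < m0 by rewrite /m0; lra.
pose B s := s `^ p - 1 - p * (s - 1).
have B0 s : 0 <= s -> 0 <= B s.
  by move=> s0; have := bernoulli_powR p1 s0; rewrite /B; lra.
have s01 : 1 < m0^-1 by rewrite invf_gt1// /m0; lra.
have Bs0 : 0 < B m0^-1.
  have := @bernoulli_powR_lt p m0^-1 p1 ltac:(lra) ltac:(by rewrite gt_eqF).
  by rewrite /B; lra.
(* Bernoulli at [s / s0] is the tangent at [s0]; its slope is at least [p] because [s0 > 1]. *)
have Bmono s : m0^-1 <= s -> B m0^-1 <= B s.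
  move=> ss0; set s0 := m0^-1 in s01 Bs0 ss0 *.
  have s0p : 0 < s0 by lra.
  have := bernoulli_powR p1 (ltW (divr_gt0 (lt_le_trans s0p ss0) s0p)).
  move=> /(ler_wpM2l (powR_ge0 s0 p)); rewrite -powRM; [|lra|by rewrite divr_ge0//; lra].
  rewrite mulrCA divff ?mulr1 ?gt_eqF//.
  have : p * (s - s0) <= s0 `^ p * (p * (s / s0 - 1)).
    have -> : s0 `^ p * (p * (s / s0 - 1)) = s0 `^ (p - 1) * (p * (s - s0)).
      rewrite -(mulr_powRB1 (ltW s0p)); last lra.
      by field; rewrite gt_eqF.
    rewrite -[leLHS]mul1r; apply: ler_wpM2r; first by apply: mulr_ge0; lra.
    rewrite -[leLHS](powRr0 s0); apply: ler_powR; lra.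
  rewrite /B; lra.
pose k1 := 2^-1 * (2^-1 `^ p * B m0^-1).
pose k2 := m0 `^ p - (1 - d) `^ p.
have k10 : 0 < k1 by rewrite !mulr_gt0// powR_gt0.
have k20 : 0 < k2.
  by rewrite subr_gt0; apply: gt0_ltr_powR; rewrite ?nnegrE /m0; lra.
exists (Num.min k1 k2); first by rewrite lt_min k10.
move=> a b c.
wlog ba : a b / b <= a.
  move=> H a0 b0; have [ba|ab] := orP (le_total b a); first exact: H.
  by have := H b a ab b0 a0; rewrite maxC (addrC b a) (addrC (b `^ p)).
rewrite max_l// => a0 b0 c0 cab cd.
move: a0; rewrite le_eqVlt => /predU1P[ae|a0].
  have -> : c = 0 by lra. have -> : b = 0 by lra.
  rewrite -ae powR0; [lra|apply/eqP; lra].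
pose e := b / a; pose f := c / a.
have e0 : 0 <= e by rewrite divr_ge0// ltW.
have f0 : 0 <= f by rewrite divr_ge0// ltW.
have bE : b = a * e by rewrite /e mulrCA divff ?mulr1// gt_eqF.
have cE : c = a * f by rewrite /f mulrCA divff ?mulr1// gt_eqF.
have e1 : e <= 1 by rewrite /e ler_pdivrMr// mul1r.
clearbody e f.
have fe : f <= (1 + e) / 2 by rewrite -(ler_pM2l a0) -cE (le_trans cab)// bE; lra.
have fd : f <= 1 - d by rewrite -(ler_pM2l a0) -cE mulrC.
rewrite bE cE !powRM ?(ltW a0)//.
suff H : Num.min k1 k2 <= (1 + e `^ p) / 2 - f `^ p.
  have := ler_wpM2l (powR_ge0 a p) H; lra.
pose m := (1 + e) / 2; have m0' : 0 < m by rewrite /m; lra.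
have fm : f <= m by [].
(* The linear terms of the two excesses cancel since [1 / m + e / m = 2]. *)
have h4 : m `^ p * (B (1 / m) + B (e / m)) = 1 + e `^ p - 2 * m `^ p.
  rewrite /B.
  have -> : m `^ p * ((1 / m) `^ p - 1 - p * (1 / m - 1) +
      ((e / m) `^ p - 1 - p * (e / m - 1))) =
      m `^ p * (1 / m) `^ p + m `^ p * (e / m) `^ p - 2 * m `^ p
      - m `^ p * p * ((1 + e) / m - 2).
    by field; rewrite gt_eqF.
  have -> : (1 + e) / m = 2 by rewrite /m; field; apply/eqP; lra.
  have r0 : 0 <= m by exact: ltW.
  have r1 : 0 <= 1 / m by exact: divr_ge0.
  have r2 : 0 <= e / m by exact: divr_ge0.
  rewrite -!powRM//.
  rewrite ![m * (_ / m)]mulrCA divff ?gt_eqF// !mulr1 powR1; lra.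
rewrite ge_min; apply/orP.
have [mle|mgt] := leP m m0; [left|right]; last first.
  have h1 : f `^ p <= (1 - d) `^ p by apply: ge0_ler_powR; rewrite ?nnegrE; lra.
  have h2 : m0 `^ p <= m `^ p by apply: ge0_ler_powR; rewrite ?nnegrE; lra.
  have h3 : 0 <= m `^ p * (B (1 / m) + B (e / m)).
    by rewrite mulr_ge0 ?powR_ge0// addr_ge0// B0// divr_ge0// ltW.
  rewrite /k2; lra.
have h1 : f `^ p <= m `^ p by apply: ge0_ler_powR; rewrite ?nnegrE; lra.
have h2 : 2^-1 `^ p <= m `^ p.
  by apply: ge0_ler_powR; rewrite ?nnegrE /m; lra.
have h3 : B m0^-1 <= B (1 / m) + B (e / m).
  have := Bmono (1 / m) ltac:(by rewrite div1r lef_pV2).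
  by have := B0 (e / m) ltac:(by rewrite divr_ge0// ltW); lra.
have h5 : 2^-1 `^ p * B m0^-1 <= m `^ p * (B (1 / m) + B (e / m)).
  exact: ler_pM (powR_ge0 _ _) (ltW Bs0) h2 h3.
rewrite /k1; lra.
Qed.

End RealPowers.

(** * Bounded linear functionals and the dual norm *)

Section DualFunctionals.
Variables (R : realType).
Implicit Types V W : normedModType R.

Section Linear.
Variables (V W : normedModType R) (f : V -> W).
Hypothesis lf : islin f.

Lemma islin0 : f 0 = 0.
Proof.
have := lf (- 1) 0 0; rewrite scaler0 addr0 scaleN1r => ->.
by rewrite addNr.
Qed.

Lemma islinZ a v : f (a *: v) = a *: f v.
Proof. by have := lf a v 0; rewrite !addr0 islin0 addr0. Qed.

Lemma islinD u v : f (u + v) = f u + f v.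
Proof. by have := lf 1 u v; rewrite !scale1r. Qed.

Lemma islinN v : f (- v) = - f v.
Proof. by rewrite -scaleN1r islinZ scaleN1r. Qed.

Lemma islinB u v : f (u - v) = f u - f v.
Proof. by rewrite islinD islinN. Qed.

End Linear.

Section Dual.
Variable V : normedModType R.
Implicit Types (f g : V -> R) (v : V).

Lemma dualZ f : isDual f -> forall (a : R) v, f (a *: v) = a * f v.
Proof. by move=> [lf _] a v; exact: islinZ lf a v. Qed.

Lemma dualD f : isDual f -> forall u v, f (u + v) = f u + f v.
Proof. by move=> [lf _] u v; exact: islinD lf u v. Qed.

Lemma dualB f : isDual f -> forall u v, f (u - v) = f u - f v.
Proof. by move=> [lf _] u v; exact: islinB lf u v. Qed.

Lemma dualN f : isDual f -> forall v, f (- v) = - f v.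
Proof. by move=> [lf _] v; exact: islinN lf v. Qed.

Lemma dual0 f : isDual f -> f 0 = 0.
Proof. by move=> [lf _]; exact: islin0 lf. Qed.

Lemma isDual_bounded f : isDual f ->
  exists2 C, 0 < C & forall v, `|f v| <= C * `|v|.
Proof.
move=> df; have [_ cf] := df.
have /cvgrPdist_lt/(_ 1 ltr01) := cf 0.
rewrite (dual0 df) => /nbhs_normP[e /= e0 He].
have fZ := dualZ df.
exists (2 / e) => [|v]; first by rewrite divr_gt0.
have [->|v0] := eqVneq v 0; first by rewrite (dual0 df) !normr0 mulr0.
have nv : 0 < `|v| by rewrite normr_gt0.
have := He ((e / 2 / `|v|) *: v); rewrite /= !sub0r !normrN normrZ fZ (normrM _ (f v)).
have -> : `|e / 2 / `|v| | = e / 2 / `|v| by rewrite ger0_norm// !divr_ge0// ltW.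
rewrite divfK ?gt_eqF// => /(_ ltac:(lra)) h.
have k0 : 0 < 2 / e * `|v| by rewrite mulr_gt0// divr_gt0.
have := ltr_pM2l k0 (e / 2 / `|v| * `|f v|) 1; rewrite h => /idP.
have -> : 2 / e * `|v| * (e / 2 / `|v| * `|f v|) = `|f v|.
  by field; rewrite !gt_eqF.
by rewrite mulr1 => /ltW.
Qed.

Lemma bounded_isDual f C : islin (f : V -> R^o) ->
  (forall v, `|f v| <= C * `|v|) -> isDual f.
Proof.
move=> lf bf; split=> // x; apply/cvgrPdist_lt => e e0.
pose C' := `|C| + 1; have C'0 : 0 < C' by rewrite ltr_wpDl.
apply/nbhs_normP; exists (e / C') => /= [|y]; first by rewrite /= divr_gt0.
move=> xy; have := islinB lf x y; rewrite -[f x - f y]/(f x - f y : R) => <-.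
apply: le_lt_trans (bf _) _.
apply: (@le_lt_trans _ _ (C' * `|x - y|)).
  by apply: ler_wpM2r => //; rewrite /C' (le_trans (ler_norm _))// lerDl.
by rewrite mulrC -ltr_pdivlMr.
Qed.

Lemma dnorm_has_sup f : isDual f ->
  has_sup [set `|f v| | v in [set v : V | `|v| <= 1]].
Proof.
move=> df; split; first by exists `|f 0|; exists 0 => //=; rewrite normr0.
have [C C0 HC] := isDual_bounded df.
exists C => _ [v /= v1 <-]; apply: le_trans (HC v) _.
by rewrite -[leRHS]mulr1 ler_pM2l.
Qed.

Lemma dnorm_ge0 f : isDual f -> 0 <= dnorm f.
Proof.
move=> /dnorm_has_sup df; apply: (@le_trans _ _ `|f 0|) => //.
by apply: (sup_upper_bound df); exists 0 => //=; rewrite normr0.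
Qed.

Lemma dnormP f v : isDual f -> `|f v| <= dnorm f * `|v|.
Proof.
move=> df; have [->|v0] := eqVneq v 0.
  by rewrite (dual0 df) !normr0 mulr0.
have nv : 0 < `|v| by rewrite normr_gt0.
rewrite -ler_pdivrMr//; apply: (sup_upper_bound (dnorm_has_sup df)).
exists (`|v|^-1 *: v) => /=.
  by rewrite normrZ normfV normr_id mulVf// gt_eqF.
by rewrite (dualZ df) normrM normfV normr_id mulrC.
Qed.

Lemma dual_le_dnorm f v : isDual f -> f v <= dnorm f * `|v|.
Proof. by move=> df; exact: le_trans (ler_norm _) (dnormP v df). Qed.

Lemma dnorm_le f C : 0 <= C -> (forall v, `|f v| <= C * `|v|) -> dnorm f <= C.
Proof.
move=> C0 HC; apply: ge_sup; first by exists `|f 0|; exists 0 => //=; rewrite normr0.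
move=> _ [v /= v1 <-]; apply: le_trans (HC v) _.
by rewrite -[leRHS]mulr1; apply: ler_wpM2l.
Qed.

Lemma dnorm_approx f e : isDual f -> 0 < e ->
  exists2 v, `|v| <= 1 & dnorm f - e < f v.
Proof.
move=> df e0; have [_ [v /= v1 <-]] := sup_adherent e0 (dnorm_has_sup df).
case: (lerP 0 (f v)) => f0 h; [exists v|exists (- v)]; rewrite ?normrN//.
  by rewrite -(ger0_norm f0).
by rewrite (dualN df) -(ltr0_norm f0).
Qed.

Lemma isDual_lincomb a f g : isDual f -> isDual g ->
  isDual (fun v => a * f v + g v).
Proof.
move=> df dg; apply: (@bounded_isDual _ (`|a| * dnorm f + dnorm g)) => [b u v|v].
  rewrite !dualD// !dualZ// -[_ *: _]/(_ * _); ring.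
apply: le_trans (ler_normD _ _) _; rewrite mulrDl; apply: lerD; last exact: dnormP.
by rewrite normrM -mulrA ler_wpM2l// dnormP.
Qed.

Lemma isDual_cst0 : isDual (fun _ : V => 0).
Proof.
by apply: (@bounded_isDual _ 0) => [b u v|v]; rewrite ?scaler0 ?addr0 ?normr0 ?mul0r.
Qed.

Lemma isDualZ a f : isDual f -> isDual (fun v => a * f v).
Proof.
move=> df; have := isDual_lincomb a df isDual_cst0.
by congr isDual; apply/funext => v; rewrite addr0.
Qed.

Lemma isDual_sub f g : isDual f -> isDual g -> isDual (fun v => f v - g v).
Proof.
move=> df dg; have := isDual_lincomb (- 1) dg df.
by congr isDual; apply/funext => v; rewrite mulN1r addrC.
Qed.

Lemma isDual_sum n (c : nat -> R) (F : nat -> V -> R) :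
  (forall i, (i < n)%N -> isDual (F i)) ->
  isDual (fun v => \sum_(i < n) c i * F i v).
Proof.
elim: n => [_|n IH H].
  by have := isDual_cst0; congr isDual; apply/funext => v; rewrite big_ord0.
have dF : isDual (F n) by exact: H.
have := isDual_lincomb (c n) dF (IH (fun i ni => H i (leqW ni))).
by congr isDual; apply/funext => v; rewrite big_ord_recr/= addrC.
Qed.

Lemma isDual_subsum n f (c : nat -> R) (F : nat -> V -> R) :
  isDual f -> (forall i, (i < n)%N -> isDual (F i)) ->
  isDual (fun v => f v - \sum_(i < n) c i * F i v).
Proof. by move=> df dF; apply: isDual_sub => //; exact: isDual_sum. Qed.

Lemma dnormZ a f : isDual f -> dnorm (fun v => a * f v) <= `|a| * dnorm f.
Proof.
move=> df; apply: dnorm_le => [|v]; first by rewrite mulr_ge0// dnorm_ge0.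
by rewrite normrM -mulrA ler_wpM2l// dnormP.
Qed.

(** Lets weak convergence in the dual be tested pointwise. *)
Lemma evaluation_isBidual v : isBidual (fun f : V -> R => f v).
Proof.
split=> //; exists `|v| => f df; rewrite mulrC; exact: dnormP.
Qed.

End Dual.

Section Composition.
Variables (X Y : normedModType R) (A : X -> Y) (C : R).
Hypotheses (lA : islin A) (C0 : 0 <= C) (bA : forall z, `|A z| <= C * `|z|).

Lemma dual_comp_bound g z : isDual g -> `|g (A z)| <= C * dnorm g * `|z|.
Proof.
move=> dg; apply: le_trans (dnormP _ dg) _.
by rewrite mulrAC mulrC ler_wpM2r// dnorm_ge0.
Qed.

Lemma isDual_comp g : isDual g -> isDual (fun z => g (A z)).
Proof.
move=> dg; apply: (@bounded_isDual _ _ (C * dnorm g)) => [b u v|v].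
  by rewrite lA dualD// dualZ.
exact: dual_comp_bound.
Qed.

Lemma dnorm_comp g : isDual g -> dnorm (fun z => g (A z)) <= C * dnorm g.
Proof.
move=> dg; apply: dnorm_le => [|v]; last exact: dual_comp_bound.
by rewrite mulr_ge0// dnorm_ge0.
Qed.

End Composition.
End DualFunctionals.

(** * Convexity of powers and rescaled uniform convexity *)

Section UniformConvexity.
Variable R : realType.

(** The tangents at the convex combination [c], taken at [a] and [b] with weights [1 - t] and [t],
    average to the power of [c]. *)
Lemma powR_convex (p a b t : R) : 1 < p -> 0 <= a -> 0 <= b -> 0 <= t <= 1 ->
  ((1 - t) * a + t * b) `^ p <= (1 - t) * a `^ p + t * b `^ p.
Proof.
move=> p1 a0 b0 /andP[t0 t1]; set c := (1 - t) * a + t * b.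
have : 0 <= c by rewrite addr_ge0// mulr_ge0// subr_ge0.
rewrite le_eqVlt => /predU1P[<-|c0].
  rewrite powR0; last by apply/eqP; lra.
  by rewrite addr_ge0// mulr_ge0 ?powR_ge0// subr_ge0.
have tangent d : 0 <= d -> c `^ p * (1 + p * (d / c - 1)) <= d `^ p.
  move=> d0; have d1 : 0 <= d / c by rewrite divr_ge0// ltW.
  have := ler_wpM2l (powR_ge0 c p) (bernoulli_powR p1 d1).
  by rewrite -(powRM _ (ltW c0) d1) mulrCA divff ?gt_eqF// mulr1.
have t1' : 0 <= 1 - t by rewrite subr_ge0.
apply: le_trans (lerD (ler_wpM2l t1' (tangent a a0)) (ler_wpM2l t0 (tangent b b0))).
have -> : (1 - t) * (c `^ p * (1 + p * (a / c - 1))) + t * (c `^ p * (1 + p * (b / c - 1)))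
  = c `^ p + c `^ p * p * (((1 - t) * a + t * b) / c - 1).
  by field; rewrite gt_eqF.
by rewrite -/c divff ?gt_eqF// subrr mulr0 addr0.
Qed.

(** Scaling by [M^-1] leaves a separation of at least [eps / B], so one modulus serves all radii
    [M <= B]. *)
Lemma unif_convex_ball (V : normedModType R) (B eps : R) :
  unif_convex V -> 0 < B -> 0 < eps -> exists2 d, 0 < d &
    forall (x z : V) M, M <= B -> `|x| <= M -> `|z| <= M -> eps <= `|x - z| ->
      `|2^-1 *: (x + z)| <= (1 - d) * M.
Proof.
move=> ucV B0 e0; have [small|big] := lerP (eps / B) 2; last first.
  exists 1 => // x z M MB xM zM exz; exfalso.
  move: big; rewrite ltr_pdivlMr// => big.
  have := ler_normB x z; lra.
have [|d [d0 Hd]] := ucV (eps / B); first by rewrite small andbT divr_gt0.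
exists d => // x z M MB xM zM exz.
have M0 : 0 < M by have := ler_normB x z; lra.
have scale (v : V) : `|M^-1 *: v| = `|v| / M.
  by rewrite normrZ ger0_norm ?invr_ge0 ?ltW// mulrC.
have := Hd (M^-1 *: x) (M^-1 *: z).
rewrite -scalerBr -scalerDr !scale => H.
have unit (v : V) : `|v| <= M -> `|v| / M <= 1 by rewrite ler_pdivrMr ?mul1r.
have exz' : eps / B <= `|x - z| / M.
  apply: (@le_trans _ _ (eps / M)); first by rewrite ler_pM2l// lef_pV2.
  by rewrite ler_pM2r// invr_gt0.
have := H (unit x xM) (unit z zM) exz'.
by rewrite scalerA mulrC -scalerA scale ler_pdivrMr.
Qed.

End UniformConvexity.

(** * Bregman distances and smoothness of the conjugate norm power *)

Section Bregman.
Variables (R : realType) (X : normedModType R) (p : R) (J : X -> X -> R).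
Hypotheses (p1 : 1 < p) (dJ : duality_map p J).

Local Notation ps := (p / (p - 1)).
Local Notation D := (bregman p J).

Lemma p_gt0 : 0 < p. Proof. exact: lt_trans ltr01 p1. Qed.

Lemma conjugate_gt0 : 0 < ps.
Proof. by rewrite divr_gt0 ?p_gt0// subr_gt0. Qed.

Lemma conjugate_sum : ps^-1 + p^-1 = 1.
Proof.
have pm : p - 1 != 0 by rewrite gt_eqF// subr_gt0.
have p0 : p != 0 by rewrite gt_eqF// p_gt0.
by field; rewrite p0 pm.
Qed.

Lemma conjugate_mul : (p - 1) * ps = p.
Proof. by rewrite mulrC divfK// gt_eqF// subr_gt0. Qed.

Lemma conjugate_mulB : (ps - 1) * p = ps.
Proof.
have pm : p - 1 != 0 by rewrite gt_eqF// subr_gt0.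
by field.
Qed.

Lemma duality_isDual x : isDual (J x). Proof. by have [] := dJ x. Qed.

Lemma duality_diag x : J x x = `|x| `^ p. Proof. by have [_ []] := dJ x. Qed.

Lemma dnorm_duality x : dnorm (J x) = `|x| `^ (p - 1).
Proof. by have [_ []] := dJ x. Qed.

Lemma dnorm_duality_conj x : dnorm (J x) `^ ps = `|x| `^ p.
Proof. by rewrite dnorm_duality -powRrM conjugate_mul. Qed.

Lemma bregman_ge_norms x z :
  ps^-1 * `|x| `^ p - `|x| `^ (p - 1) * `|z| + p^-1 * `|z| `^ p <= D x z.
Proof.
by rewrite lerD2r lerD2l lerN2 -dnorm_duality; exact/dual_le_dnorm/duality_isDual.
Qed.

(** Young's inequality for the exponents [ps] and [p]. *)
Lemma bregman_ge0 x z : 0 <= D x z.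
Proof.
apply: le_trans (bregman_ge_norms x z).
have := conjugate_powR (powR_ge0 `|x| (p - 1)) (normr_ge0 z) conjugate_gt0 p_gt0
  conjugate_sum.
rewrite -powRrM conjugate_mul; lra.
Qed.

(** Nonnegativity of [D x] at the midpoint bounds [J x z] from above; inserting this in [D x z]
    leaves the convexity gap of the norm power. *)
Lemma bregman_ge_gap x z :
  2 * p^-1 * ((`|x| `^ p + `|z| `^ p) / 2 - `|2^-1 *: (x + z)| `^ p) <= D x z.
Proof.
have := bregman_ge0 x (2^-1 *: (x + z)); rewrite /bregman.
have dJx := duality_isDual x.
rewrite (dualZ dJx) (dualD dJx) duality_diag.
have := congr1 (fun c => c * `|x| `^ p) conjugate_sum; lra.
Qed.

(** [D x] is convex and vanishes at [x]. *)
Lemma bregman_segment x z t : 0 <= t <= 1 -> D x (x + t *: (z - x)) <= t * D x z.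
Proof.
move=> t01; have /andP[t0 t1] := t01.
have nle : `|x + t *: (z - x)| <= (1 - t) * `|x| + t * `|z|.
  have -> : x + t *: (z - x) = (1 - t) *: x + t *: z.
    by rewrite scalerBr scalerBl scale1r addrCA addrC -addrA addrC.
  apply: le_trans (ler_normD _ _) _.
  by rewrite !normrZ (ger0_norm t0) ger0_norm// subr_ge0.
have : `|x + t *: (z - x)| `^ p <= (1 - t) * `|x| `^ p + t * `|z| `^ p.
  apply: le_trans (powR_convex p1 (normr_ge0 x) (normr_ge0 z) t01).
  apply: ge0_ler_powR; rewrite ?nnegrE ?(ltW p_gt0)//.
  by rewrite addr_ge0// mulr_ge0// subr_ge0.
have pV0 : 0 <= p^-1 by rewrite invr_ge0 ltW// p_gt0.
move=> /(ler_wpM2l pV0).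
have dJx := duality_isDual x.
rewrite /bregman (dualD dJx) (dualZ dJx) (dualB dJx) duality_diag.
have := congr1 (fun c => (1 - t) * c * `|x| `^ p) conjugate_sum; lra.
Qed.

Hypothesis ucX : unif_convex X.

(** Uniform convexity gives a positive bound [c] on the sphere of radius [eps] about [x]; convexity
    along the segment to [z] extends it outwards with slope [c / eps]. *)
Lemma bregman_lower_bound B eps : 0 < B -> 0 < eps -> exists2 d, 0 < d &
  forall x z, `|x| <= B -> eps <= `|x - z| -> d * `|x - z| <= D x z.
Proof.
move=> B0 e0; have Be0 : 0 < B + eps by exact: addr_gt0.
have [d d0 Hd] := unif_convex_ball ucX Be0 e0.
have [k k0 Hk] := powR_midpoint_gap p1 d0.
pose c := 2 * p^-1 * (k * (eps / 2) `^ p).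
have c0 : 0 < c.
  by rewrite !mulr_gt0 ?invr_gt0 ?p_gt0// powR_gt0// divr_gt0.
have far x z : `|x| <= B -> `|x - z| = eps -> c <= D x z.
  move=> xB exz; apply: le_trans (bregman_ge_gap x z).
  rewrite ler_pM2l; last by rewrite mulr_gt0// invr_gt0 p_gt0.
  set M := Num.max `|x| `|z|.
  have xM : `|x| <= M by rewrite le_max lexx.
  have zM : `|z| <= M by rewrite le_max lexx orbT.
  have eM : eps / 2 <= M by have := ler_normB x z; lra.
  have MB : M <= B + eps.
    rewrite ge_max; apply/andP; split; first lra.
    by have := ler_normB x (x - z); rewrite opprB addrCA subrr addr0; lra.
  have mid : `|2^-1 *: (x + z)| <= (`|x| + `|z|) / 2.
    rewrite normrZ ger0_norm// mulrC ler_pM2r//; exact: ler_normD.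
  apply: le_trans (Hk _ _ _ (normr_ge0 x) (normr_ge0 z) (normr_ge0 _) mid _).
    rewrite ler_pM2l//; apply: ge0_ler_powR; rewrite ?nnegrE ?(ltW p_gt0)//; lra.
  by apply: Hd => //; rewrite exz.
exists (c / eps) => [|x z xB exz]; first exact: divr_gt0.
have xz0 : 0 < `|x - z| by exact: lt_le_trans exz.
pose t := eps / `|x - z|.
have t0 : 0 < t by exact: divr_gt0.
have t01 : 0 <= t <= 1 by rewrite ltW//= ler_pdivrMr// mul1r.
have tE : t * `|x - z| = eps by rewrite divfK// gt_eqF.
have := far x (x + t *: (z - x)) xB.
rewrite opprD addrA subrr sub0r normrN normrZ (distrC z) gtr0_norm// tE => /(_ erefl) h.
have h' := le_trans h (bregman_segment x z t01).
have -> : D x z = t * D x z / eps * `|x - z|.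
  by rewrite -tE; field; rewrite !gt_eqF.
by rewrite ler_wpM2r// ler_pM2r// invr_gt0.
Qed.

(* The map [f |-> dnorm f `^ ps / ps] is the convex conjugate of
   [z |-> `|z| `^ p / p]; approximate maximizers need no reflexivity. *)
Lemma conjugate_approx (f : X -> R) eta : isDual f -> 0 < eta ->
  exists z, ps^-1 * dnorm f `^ ps - eta < f z - p^-1 * `|z| `^ p.
Proof.
move=> df eta0; set a := dnorm f; have a0 : 0 <= a := dnorm_ge0 df.
(* [b] is the length giving equality in Young's inequality with [a]. *)
set b := a `^ (ps - 1); have b0 : 0 <= b := powR_ge0 _ _.
have e0 : 0 < eta / (b + 1) by rewrite divr_gt0// ltr_wpDl.
have [v v1 fv] := dnorm_approx df e0.
exists (b *: v); rewrite (dualZ df) normrZ (ger0_norm b0).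
have h1 : (b * `|v|) `^ p <= a `^ ps.
  rewrite -conjugate_mulB powRrM -/b.
  apply: ge0_ler_powR; rewrite ?nnegrE ?mulr_ge0 ?(ltW p_gt0)//.
  by rewrite -[leRHS]mulr1 ler_wpM2l.
have h2 : b * a = a `^ ps by rewrite mulrC mulr_powRB1// conjugate_gt0.
have h3 : b * (eta / (b + 1)) < eta.
  by rewrite mulrCA -[ltRHS]mulr1 ltr_pM2l// ltr_pdivrMr ?ltr_wpDl// mul1r ltrDl.
have h4 := ler_wpM2l b0 (ltW fv).
have pV0 : 0 <= p^-1 by rewrite invr_ge0 ltW// p_gt0.
have h5 := ler_wpM2l pV0 h1.
have h6 := congr1 (fun c => c * a `^ ps) conjugate_sum.
move: h4 h6; rewrite mulrBr -/a h2; lra.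
Qed.

(** A derivative bound at [J x], uniform over bounded [x]. For an almost maximizer [z] of the
    conjugate at [J x - f], the error is [f (x - z) - D x z]: when [z] is far from [x] it is
    absorbed by the linear growth of [D x], and when [z] is near it is at most [eps * dnorm f]. *)
Lemma dual_norm_smooth B eps : 0 < B -> 0 < eps -> exists2 d, 0 < d &
  forall x f, `|x| <= B -> isDual f -> dnorm f <= d ->
    ps^-1 * dnorm (fun z => J x z - f z) `^ ps <=
    ps^-1 * `|x| `^ p - f x + eps * dnorm f.
Proof.
move=> B0 e0; have [d d0 Hd] := bregman_lower_bound B0 e0.
exists d => // x f xB df fd; apply/ler_addgt0Pr => eta eta0.
have dg := isDual_sub (duality_isDual x) df.
have [z] := conjugate_approx dg eta0.
suff : f (x - z) <= D x z + eps * dnorm f.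
  by rewrite (dualB df) /bregman; lra.
have [far|near] := lerP eps `|x - z|.
  apply: le_trans (dual_le_dnorm _ df) _.
  have := Hd x z xB far; have := ler_wpM2r (normr_ge0 (x - z)) fd.
  have := mulr_ge0 (ltW e0) (dnorm_ge0 df); lra.
apply: le_trans (dual_le_dnorm _ df) _.
have := bregman_ge0 x z; have := ler_wpM2l (dnorm_ge0 df) (ltW near); lra.
Qed.

Lemma bregman_coercive c K : exists2 B, 0 < B &
  forall x z, `|z| <= K -> D x z <= c -> `|x| <= B.
Proof.
have ps0 := conjugate_gt0.
(* As [ps^-1] is twice [q^-1], half of the leading term pays for the cross term and the other half
   exceeds [c]. The summand 1 in [B] ensures [1 <= |x|]. *)
have [q q0 qE] : exists2 q : R, 0 < q & q = 2 * ps.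
  by exists (2 * ps) => //; exact: mulr_gt0.
pose B := q * `|K| + 1 + q * `|c|.
have h1 : 0 <= q * `|K| by apply: mulr_ge0 => //; exact: ltW.
have h2 : 0 <= q * `|c| by apply: mulr_ge0 => //; exact: ltW.
exists B => [|x z zK Dc]; first by rewrite /B; lra.
rewrite leNgt; apply/negP => Bx.
have x1 : 1 <= `|x| by rewrite /B in Bx; lra.
have xp : `|x| <= `|x| `^ p by exact: le1r_powR x1 (ltW p1).
have := bregman_ge_norms x z.
have h3 : 0 <= p^-1 * `|z| `^ p.
  by rewrite mulr_ge0 ?powR_ge0// invr_ge0 ltW// p_gt0.
have h4 : `|x| `^ (p - 1) * `|z| <= q^-1 * `|x| `^ p.
  rewrite -(mulr_powRB1 (normr_ge0 x) p_gt0) mulrA mulrC ler_wpM2r ?powR_ge0//.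
  rewrite mulrC ler_pdivlMr // mulrC.
  apply: (@le_trans _ _ (q * `|K|)).
    by rewrite ler_pM2l // (le_trans zK)// ler_norm.
  by rewrite /B in Bx; lra.
have h5 : c < q^-1 * `|x| `^ p.
  rewrite mulrC ltr_pdivlMr // mulrC.
  apply: (@le_lt_trans _ _ (q * `|c|)); last by rewrite /B in Bx; lra.
  by rewrite ler_pM2l // ler_norm.
have -> : ps^-1 = q^-1 + q^-1.
  have pm : p - 1 != 0 by rewrite gt_eqF// subr_gt0.
  by rewrite qE; field; rewrite pm gt_eqF// p_gt0.
lra.
Qed.

End Bregman.

(** * Epsilon form of limits of real sequences *)

Section Sequences.
Variable R : realType.

Lemma cvg_seqP (u : nat -> R) (l : R) : u @ \oo --> l <->
  forall e, 0 < e -> exists N, forall n, (N <= n)%N -> `|u n - l| < e.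
Proof.
split=> [/cvgrPdist_lt H e /H[N _ HN]|H].
  by exists N => n Nn; rewrite distrC; exact: HN.
apply/cvgrPdist_lt => e /H[N HN]; exists N => // n /= Nn.
by rewrite distrC; exact: HN.
Qed.

Lemma natSinv_lt (e : R) : 0 < e -> exists n, n.+1%:R^-1 < e.
Proof.
by move=> e0; have := near_infty_natSinv_lt (PosNum e0) => /filter_ex[n]; exists n.
Qed.

End Sequences.

(** A dyadic form of the convex hull: uniform convexity compares midpoints, and lower bounds by
    linear functionals pass to them. *)
Inductive midpoint_hull (R : realType) (V : normedModType R) (S : set V) : V -> Prop :=
| midpoint_hull_in v : S v -> midpoint_hull S v
| midpoint_hull_mid u v : midpoint_hull S u -> midpoint_hull S v ->
    midpoint_hull S (2^-1 *: (u + v)).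

(** * Weak limits along ultrafilters *)

Section UltrafilterLimit.
Variables (R : realType) (X : completeNormedModType R).
Hypothesis ucX : unif_convex X.

Lemma midpoint_hullS (S T : set X) : S `<=` T ->
  midpoint_hull S `<=` midpoint_hull T.
Proof.
move=> ST v; elim => [w /ST|u w _ hu _ hw]; first exact: midpoint_hull_in.
exact: midpoint_hull_mid.
Qed.

Lemma midpoint_hull_ge (S : set X) (f : X -> R) a : isDual f ->
  (forall v, S v -> a <= f v) -> forall v, midpoint_hull S v -> a <= f v.
Proof.
move=> df H v; elim => [w /H//|u w _ hu _ hw].
rewrite (dualZ df) (dualD df); lra.
Qed.

(* The limit is that of the filter of almost minimal-norm elements of the
   midpoint hulls of the sets of the ultrafilter, which is Cauchy by uniform
   convexity. *)
Lemma ultrafilter_weak_limit (U : set_system nat) (x : nat -> X) (B : R) :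
  UltraFilter U -> (forall n, `|x n| <= B) ->
  exists l, forall f, isDual f -> forall e, 0 < e -> U [set n | f l - e < f (x n)].
Proof.
move=> UU xB; have PU : ProperFilter U by exact: ultra_proper.
pose H (S : set nat) := midpoint_hull (x @` S).
have HS S T : S `<=` T -> H S `<=` H T.
  by move=> ST; apply: midpoint_hullS; exact: image_subset.
(* [E] collects the lower bounds for the norm on the hulls; its supremum [rho] is the level that
   almost minimal elements approach. *)
pose E := [set m : R | exists2 S, U S & forall c, H S c -> m <= `|c|].
have E0 : E 0 by exists setT => //; exact: filterT.
have Eub : ubound E B.
  move=> m [S US HSm]; have [n Sn] := filter_ex US.
  by apply: le_trans (xB n); apply: HSm; apply: midpoint_hull_in; exists n.
have supE : has_sup E by split; [exists 0|exists B].
pose rho := sup E.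
have rho0 : 0 <= rho by exact: sup_upper_bound supE _ E0.
pose G (i : set nat * R) := [set c | H i.1 c /\ `|c| < rho + i.2].
pose I := [set i : set nat * R | U i.1 /\ 0 < i.2].
have Gne i : I i -> G i !=set0.
  case: i => S e [/= US e0]; apply: contrapT => Gn.
  have : E (rho + e).
    exists S => // c HSc; rewrite leNgt; apply/negP => ce; apply: Gn.
    by exists c; split.
  move=> /(sup_upper_bound supE); rewrite -/rho; lra.
pose F := filter_from I G.
have FF : Filter F.
  apply: filter_from_filter; first by exists (setT, 1); split => //=; exact: filterT.
  move=> [S e] [T d] [/= US e0] [/= UT d0].
  exists (S `&` T, Num.min e d).
    by split => /=; [exact: filterI|rewrite lt_min e0].
  move=> c [/= Hc]; rewrite -ltrBlDl lt_min => /andP[ce cd].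
  split; split => /=; [|lra| |lra].
    by apply: HS Hc => n [].
  by apply: HS Hc => n [].
have PF : ProperFilter F by exact: filter_from_proper.
have cF : cauchy F.
  apply: cauchy_exP => e e0.
  have rho1 : 0 < rho + 1 by lra.
  have [d d0 Hd] := unif_convex_ball ucX rho1 e0.
  (* Two almost minimal elements at distance [e] would have a midpoint of norm at most
     [(1 - d) * (rho + eta)]. Since [e <= 2 * (rho + eta)], this [eta] makes it smaller than
     [rho - eta < m]. *)
  pose eta := Num.min 1 (d * e / 8).
  have de0 : 0 < d * e by exact: mulr_gt0.
  have eta0 : 0 < eta by rewrite lt_min ltr01/= divr_gt0.
  have eta1 : eta <= 1 by rewrite ge_min lexx.
  have eta2 : eta <= d * e / 8 by rewrite ge_min lexx orbT.
  have [m [S US HSm] rm] := sup_adherent eta0 supE.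
  have [c0 [/= Hc0 nc0]] := Gne (S, eta) (conj US eta0).
  exists c0; exists (S, eta) => // c [/= Hc nc].
  rewrite -ball_normE /= ltNge; apply/negP => far.
  have Mr : rho + eta <= rho + 1 by lra.
  have := Hd c0 c (rho + eta) Mr (ltW nc0) (ltW nc) far.
  have := HSm _ (midpoint_hull_mid Hc0 Hc).
  have : e <= 2 * (rho + eta) by have := ler_normB c0 c; lra.
  move=> /(ler_wpM2l (ltW d0)); rewrite -/rho in rm; lra.
have Fl : F --> lim F := cauchy_cvg F cF.
set l := lim F in Fl.
exists l => f df e e0.
(* Otherwise the complement belongs to [U], and hull elements over it satisfy [f c <= f l - e]
   although they come close to [l]. *)
have [//|US] := in_ultra_setVsetC [set n | f l - e < f (x n)] UU.
exfalso.
set S := ~` _ in US.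
have : F [set c | `|f l - f c| < e].
  by have [_ /(_ l)/cvgrPdist_lt/(_ e e0)] := df; exact: Fl.
move=> [[T eta] [/= UT eta0] sub].
have [c [/= Hc nc]] := Gne (S `&` T, eta) (conj (filterI US UT) eta0).
have : `|f l - f c| < e by apply: sub; split => //=; apply: HS Hc => n [].
have dNf : isDual (fun v => - 1 * f v) by exact: isDualZ.
have := midpoint_hull_ge dNf (a := e - f l) _ Hc.
have fx v : (x @` (S `&` T)) v -> e - f l <= - 1 * f v.
  by move=> [n [/negP Sn _] <-]; move: Sn; rewrite -leNgt; lra.
by move=> /(_ fx) h; rewrite ltr_norml; lra.
Qed.

End UltrafilterLimit.

(** * Weakly convergent subsequences of bounded sequences *)

Section WeakSubsequence.
Variables (R : realType) (X : completeNormedModType R) (p : R) (J : X -> X -> R).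
Hypotheses (ucX : unif_convex X) (p1 : 1 < p) (dJ : duality_map p J).

(* If [f] had positive distance [rho] to the space [W] of functionals tending
   to 0 along [z], in the seminorm [q] of the sup over the unit ball of [D], a
   small multiple of [J d], with [d] almost maximizing the almost optimal
   difference [g], could be subtracted from [g] to bring [q g] below [rho]. *)
Lemma duality_functionals_determine (D : set X) (z : nat -> X) (B : R) :
  (forall u v, D u -> D v -> D (u + v)) ->
  (forall (a : rat) u, D u -> D (ratr a *: u)) ->
  (forall k, D (z k)) -> (forall k, `|z k| <= B) ->
  (forall d, D d -> (fun k => J d (z k)) @ \oo --> (0 : R)) ->
  forall f, isDual f -> (fun k => f (z k)) @ \oo --> (0 : R).
Proof.
move=> DD DZ Dz zB HJ f df.
pose Q (g : X -> R) := [set g d | d in [set d | D d /\ `|d| <= 1]].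
pose q g := sup (Q g).
have D0 : D 0 by have := DZ 0 _ (Dz 0%N); rewrite raddf0 scale0r.
have Qsup g : isDual g -> has_sup (Q g).
  move=> dg; split; first by exists (g 0), 0 => //=; rewrite normr0.
  exists (dnorm g) => _ [d /= [_ d1] <-]; apply: le_trans (dual_le_dnorm _ dg) _.
  by rewrite -[leRHS]mulr1; apply: ler_wpM2l => //; exact: dnorm_ge0.
have qP g d : isDual g -> D d -> `|d| <= 1 -> g d <= q g.
  by move=> dg Dd d1; apply: sup_upper_bound (Qsup g dg) _ _; exists d.
have qZ g d (a : rat) : isDual g -> D d -> 0 <= (ratr a : R) -> ratr a * `|d| <= 1 ->
    ratr a * g d <= q g.
  move=> dg Dd a0 ad; rewrite -(dualZ dg); apply: qP => //; first exact: DZ.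
  by rewrite normrZ ger0_norm.
pose W (g : X -> R) := isDual g /\ (fun k => g (z k)) @ \oo --> (0 : R).
pose E := [set q (fun v => f v - g v) | g in W].
have E_ge0 : lbound E 0.
  move=> _ [g [dg _] <-]; have dfg := isDual_sub df dg.
  by have := qP _ 0 dfg D0; rewrite normr0 (dual0 dfg); exact.
have infE : has_inf E.
  split; last by exists 0.
  exists (q (fun v => f v - 0)), (fun=> 0) => //; split; first exact: isDual_cst0.
  exact: cvg_cst.
pose rho := inf E.
have rho_ge0 : 0 <= rho by apply: lb_le_inf => //; case: infE.
have [rho0|rho0] := eqVneq rho 0.
  apply/cvg_seqP => e e0.
  have [N NB] : exists N : nat, B <= N.+1%:R.
    exists (Num.bound `|B|); apply: le_trans (ler_norm B) _.
    by apply/ltW/(lt_le_trans (archi_boundP (normr_ge0 B))); rewrite ler_nat.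
  have N0 : 0 < N.+1%:R :> R by [].
  have e1 : 0 < e / 2 / N.+1%:R by rewrite !divr_gt0.
  have [_ [g [dg /cvg_seqP Wg] <-]] := inf_adherent e1 infE.
  rewrite -/rho rho0 add0r => qe.
  have [M HM] := Wg (e / 2) ltac:(by rewrite divr_gt0).
  exists M => k Mk; have := HM k Mk; rewrite !subr0 => gk.
  set h := (fun v => _) in qe; have dh : isDual h by exact: isDual_sub.
  (* [D] is closed under rational scaling, so a rational factor of either sign brings [z k] into the
     unit ball and bounds [h (z k)] on both sides. *)
  have ratN (b : rat) : `|ratr b : R| = N.+1%:R^-1 -> ratr b * h (z k) < e / 2 / N.+1%:R.
    move=> bN; apply: le_lt_trans qe; rewrite -(dualZ dh); apply: qP => //.
      exact: DZ.
    by rewrite normrZ bN mulrC ler_pdivrMr// mul1r (le_trans (zB k)).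
  have r1 : (ratr (N.+1%:R^-1) : R) = N.+1%:R^-1 by rewrite fmorphV/= ratr_nat.
  have h1 := ratN (N.+1%:R^-1); rewrite r1 in h1.
  have h2 := ratN (- N.+1%:R^-1); rewrite raddfN/= r1 normrN in h2.
  have rN : `|N.+1%:R^-1 : R| = N.+1%:R^-1 by rewrite ger0_norm// invr_ge0.
  have := h1 rN; have := h2 rN.
  rewrite mulNr -mulrN ![N.+1%:R^-1 * _]mulrC !ltr_pM2r ?invr_gt0// => h3 h4.
  have -> : f (z k) = g (z k) + h (z k) by rewrite /h addrC subrK.
  by move: gk; rewrite !ltr_norml; lra.
exfalso; have {rho_ge0} {}rho0 : 0 < rho by rewrite lt_neqAle eq_sym rho0.
have half0 : 0 < 2^-1 :> R by rewrite invr_gt0.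
have [dl dl0 Hdl] := unif_convex_ball ucX ltr01 half0.
have [j jdl] := natSinv_lt dl0.
have [a [a0 a1 adl [b ab]]] : exists a : R,
    [/\ 0 < a, a <= 1, a < dl & exists b : rat, a = ratr b].
  exists j.+1%:R^-1; split => //; first by rewrite invf_le1// ler1n.
  by exists j.+1%:R^-1; rewrite fmorphV/= ratr_nat.
(* A rational enlargement that keeps midpoints contracted by [1 - dl] in the unit ball. *)
pose lam := 1 + a.
have lam1 : 1 < lam by rewrite /lam; lra.
have lam2 : lam <= 2 by rewrite /lam; lra.
have lamr : lam = ratr (1 + b) by rewrite raddfD/= rmorph1 -ab.
have lamdl : lam * (1 - dl) <= 1.
  have : 0 < a * dl by exact: mulr_gt0.
  by rewrite /lam; lra.
pose om := rho * (1 - lam^-1).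
have lamV : 2^-1 <= lam^-1 by rewrite lef_pV2// ?posrE; lra.
have lamV1 : lam^-1 < 1 by rewrite invf_lt1//; lra.
have om0 : 0 < om by rewrite mulr_gt0// subr_gt0.
have om1 : om <= rho / 2 by rewrite ler_pM2l//; lra.
have pm0 : 0 <= p - 1 by rewrite subr_ge0 ltW.
(* A lower bound for [J d v] when [|d| >= 3 / 4] and [|d - v| < 1 / 2]. *)
pose kap : R := (3 / 4) `^ (p - 1) / 4.
have kap0 : 0 < kap by rewrite divr_gt0// powR_gt0.
have kap1 : kap <= 4^-1.
  rewrite /kap ler_pdivrMr// mulVf//.
  have := @ge0_ler_powR R (p - 1) pm0 (3 / 4) 1.
  rewrite powR1; apply; rewrite ?nnegrE; lra.
pose tau := om / 3; have tau0 : 0 < tau by rewrite divr_gt0.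
pose s := tau * kap / 2; have s0 : 0 < s by rewrite divr_gt0// mulr_gt0.
have s_tau : s <= tau / 8.
  by rewrite /s; have := ler_wpM2l (ltW tau0) kap1; lra.
have [_ [g0 [dg0 Wg0] <-]] := inf_adherent s0 infE.
set g := (fun v => _); rewrite -/rho => qg.
have dg : isDual g by exact: isDual_sub.
have : E (q g) by exists g0.
move=> /(ge_inf (ex_intro _ 0 E_ge0)); rewrite -/rho => rqg.
have [_ [d /= [Dd d1] <-]] := sup_adherent s0 (Qsup g dg).
rewrite -/(q g) => gd.
(* A shorter [d] could be enlarged by [4 / 3] inside the unit ball, pushing [g] above [q g]. *)
have d34 : 3 / 4 <= `|d|.
  rewrite leNgt; apply/negP => dlt.
  have r43 : ratr (4 / 3 : rat) = 4 / 3 :> R.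
    by rewrite rmorphM/= fmorphV/= !ratr_nat.
  have := @qZ g d (4 / 3) dg Dd; rewrite r43 => /(_ ltac:(lra) ltac:(lra)).
  rewrite /tau in s_tau; lra.
have dJd := duality_isDual dJ d.
have nJd : dnorm (J d) <= 1.
  rewrite (dnorm_duality dJ).
  have := @ge0_ler_powR R (p - 1) pm0 `|d| 1.
  by rewrite powR1; apply; rewrite ?nnegrE//; lra.
pose g1 v := g0 v + tau * J d v.
have Wg1 : W g1.
  have -> : g1 = (fun v => tau * J d v + g0 v) by apply/funext => v; rewrite /g1 addrC.
  split; first exact: isDual_lincomb.
  have -> : (0 : R) = tau * 0 + 0 by rewrite mulr0 addr0.
  by apply: cvgD => //; apply: cvgMl_tmp; exact: HJ.
have : E (q (fun v => f v - g1 v)) by exists g1.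
move=> /(ge_inf (ex_intro _ 0 E_ge0)); rewrite -/rho leNgt => /negP; apply.
apply: (@le_lt_trans _ _ (rho - s)); last lra.
apply: ge_sup; first by exists (f 0 - g1 0), 0 => //=; rewrite normr0.
move=> _ [v /= [Dv v1] <-].
have -> : f v - g1 v = g v - tau * J d v by rewrite /g1 /g; ring.
have Jdv : `|J d v| <= 1.
  apply: le_trans (dnormP v dJd) _.
  by rewrite -[leRHS]mulr1 ler_pM// dnorm_ge0.
(* For [v] far from [d], the enlarged midpoint and the near-optimality of [d] force
   [g v <= rho - 2 * om + 3 * s], which leaves room for the change [tau]. For [v] near [d],
   subtracting [tau * J d v] gains at least [tau * kap = 2 * s]. *)
have [far|near] := lerP 2^-1 `|d - v|.
  have mid := Hdl d v 1 (lexx 1) d1 v1 far.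
  have := @qZ g (2^-1 *: (d + v)) (1 + b) dg.
  have Dm : D (2^-1 *: (d + v)).
    have := DZ 2^-1 _ (DD _ _ Dd Dv); rewrite fmorphV/= ratr_nat; exact.
  rewrite -lamr => /(_ Dm ltac:(lra)).
  have lm : lam * `|2^-1 *: (d + v)| <= 1.
    by apply: le_trans lamdl; rewrite mulr1 in mid; rewrite ler_pM2l//; lra.
  move=> /(_ lm); rewrite (dualZ dg) (dualD dg) mulrC -ler_pdivlMr; last lra.
  move=> h.
  have h1 : q g / lam <= rho - om + s.
    have : q g / lam <= (rho + s) / lam by rewrite ler_pM2r ?invr_gt0; lra.
    have : s / lam <= s by rewrite ler_pdivrMr ?ler_peMr; lra.
    rewrite /om; lra.
  have h2 := ler_wpM2l (ltW tau0) Jdv.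
  have h3 : - J d v <= `|J d v| by rewrite -normrN ler_norm.
  have h4 := ler_wpM2l (ltW tau0) h3.
  rewrite /tau in s_tau h2 h4 *; lra.
have Jdd : `|d| `^ p - `|d| `^ (p - 1) / 2 <= J d v.
  have -> : J d v = J d d - J d (d - v) by rewrite (dualB dJd); ring.
  rewrite (duality_diag dJ) lerD2l lerN2.
  apply: le_trans (dual_le_dnorm _ dJd) _.
  by rewrite (dnorm_duality dJ); apply: ler_wpM2l; [exact: powR_ge0|exact: ltW].
have kapJ : kap <= J d v.
  apply: le_trans Jdd; rewrite -(mulr_powRB1 (normr_ge0 d) (p_gt0 p1)).
  have h1 : (3 / 4) `^ (p - 1) <= `|d| `^ (p - 1).
    by apply: ge0_ler_powR; rewrite ?nnegrE//; lra.
  have h2 := ler_wpM2r (powR_ge0 `|d| (p - 1)) d34.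
  rewrite /kap; lra.
have := ler_wpM2l (ltW tau0) kapJ.
have := qP g v dg Dv v1.
rewrite /s in qg *; lra.
Qed.

(** The ultrafilter limit [l] is tested on the countable set of rational combinations of the
    [x n - l]. The index [m k] handles the first [k.+1] of them at once, since finite intersections
    stay in the ultrafilter. *)
Lemma bounded_weak_subsequence (x : nat -> X) (B : R) : (forall n, `|x n| <= B) ->
  exists (l : X) (m : nat -> nat), (forall k, (k <= m k)%N) /\ weak_cvg (x \o m) l.
Proof.
move=> xB.
have [U [UU ooU]] := ultraFilterLemma eventually_filter.
have PU : ProperFilter U by exact: ultra_proper.
have FU : Filter U by case: PU.
have [l Hl] := ultrafilter_weak_limit ucX UU xB.
have Hl2 f e : isDual f -> 0 < e -> U [set n | `|f (x n - l)| < e].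
  move=> df e0; have dNf : isDual (fun v => - 1 * f v) by exact: isDualZ.
  have := @filterI _ U FU _ _ (Hl _ df e e0) (Hl _ dNf e e0).
  by apply: (@filterS _ U FU) => n [/= h1 h2]; rewrite (dualB df) ltr_norml; lra.
pose comb (s : seq (rat * nat)) : X := \sum_(a <- s) ratr a.1 *: (x a.2 - l).
(* An enumeration of all combinations; indices that code no list give 0. *)
pose d i := if unpickle i is Some s then comb s else 0.
have [m Hm] : exists m : nat -> nat, forall k, (k <= m k)%N /\
    forall i, (i <= k)%N -> `|J (d i) (x (m k) - l)| < k.+1%:R^-1.
  suff /choice[m Hm] : forall k, exists n, (k <= n)%N /\
      forall i, (i <= k)%N -> `|J (d i) (x n - l)| < k.+1%:R^-1 by exists m.
  move=> k; apply: (@filter_ex _ U).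
  apply: filterI; first exact/ooU/nbhs_infty_ge.
  have k0 : 0 < k.+1%:R^-1 :> R by rewrite invr_gt0.
  have : forall j, U [set n | forall i, (i < j)%N -> `|J (d i) (x n - l)| < k.+1%:R^-1].
    elim=> [|j IH]; first by apply: filterE => n i.
    have := @filterI _ U FU _ _ IH (Hl2 _ _ (duality_isDual dJ (d j)) k0).
    apply: (@filterS _ U FU) => n [/= h1 h2] i; rewrite ltnS leq_eqVlt => /predU1P[->//|].
    exact: h1.
  by move=> /(_ k.+1).
exists l, m; split=> [k|f df]; first by have [] := Hm k.
pose D := range comb.
have Dx n : D (x n - l).
  by exists [:: (1, n)] => //; rewrite /comb big_seq1 rmorph1 scale1r.
have : (fun k => f (x (m k) - l)) @ \oo --> (0 : R).
  apply: (duality_functionals_determine (D := D)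
    (z := fun k => x (m k) - l) (B := B + `|l|)) => //.
  - move=> _ _ [s _ <-] [s' _ <-]; exists (s ++ s') => //.
    by rewrite /comb big_cat.
  - move=> a _ [s _ <-]; exists [seq (a * b.1, b.2) | b <- s] => //.
    rewrite /comb big_map scaler_sumr; apply: eq_bigr => b _ /=.
    by rewrite rmorphM/= scalerA.
  - by move=> k; apply: le_trans (ler_normB _ _) _; rewrite lerD2r.
  move=> _ [s _ <-]; apply/cvg_seqP => e /natSinv_lt[N Ne].
  exists (maxn N (pickle s)) => k; rewrite geq_max => /andP[Nk sk].
  have [_ /(_ _ sk)] := Hm k; rewrite /d pickleK subr0 => h.
  apply: lt_trans h _; apply: le_lt_trans Ne.
  by rewrite lef_pV2 ?posrE// ler_nat ltnS.
move=> /cvg_seqP H; apply/cvg_seqP => e /H[N HN]; exists N => n /HN /=.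
by rewrite subr0 (dualB df).
Qed.

End WeakSubsequence.

Lemma cvg_seq_unique (R : realType) (u : nat -> R) (l l' : R) :
  u @ \oo --> l -> u @ \oo --> l' -> l = l'.
Proof. by move=> h h'; exact: (cvg_unique (@norm_hausdorff R R) h h'). Qed.

(** * Solutions with annihilating duality image *)

Section MinimalNormSolution.
Variables (R : realType) (X Y : completeNormedModType R) (p : R) (J : X -> X -> R).
Variables (A : X -> Y) (y : Y).
Hypotheses (p1 : 1 < p) (ucX : unif_convex X) (dJ : duality_map p J) (lA : islin A).

Lemma annihilator_solution l z : (forall k, A k = 0 -> J l k = 0) ->
  A l = y -> A z = y -> J l z = J l l.
Proof.
move=> Jl Al Az; apply/eqP; rewrite -subr_eq0 -(dualB (duality_isDual dJ l)).
by rewrite Jl// (islinB lA) Al Az subrr.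
Qed.

Lemma bregman_solution l z : (forall k, A k = 0 -> J l k = 0) ->
  A l = y -> A z = y -> bregman p J l z = p^-1 * (`|z| `^ p - `|l| `^ p).
Proof.
move=> Jl Al Az; rewrite /bregman (annihilator_solution Jl Al Az) (duality_diag dJ).
have := congr1 (fun c => c * `|l| `^ p) (conjugate_sum p1); lra.
Qed.

(** On the solution set the Pythagorean identity [D x0 z = D x0 l + D l z] holds. *)
Lemma annihilator_is_bregman_proj x0 l : (forall k, A k = 0 -> J x0 k = 0) ->
  (forall k, A k = 0 -> J l k = 0) -> A l = y ->
  is_bregman_proj p J [set z | A z = y] x0 l.
Proof.
move=> Jx Jl Al; split=> //= z Az.
have -> : bregman p J x0 z = bregman p J x0 l + bregman p J l z.
  rewrite (bregman_solution Jl Al Az) /bregman.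
  have -> : J x0 z = J x0 l.
    apply/eqP; rewrite -subr_eq0 -(dualB (duality_isDual dJ x0)).
    by rewrite Jx// (islinB lA) Al Az subrr.
  ring.
by rewrite lerDl bregman_ge0.
Qed.

(** The distances from [l] to [l'] and back add up to 0, whereas the first would be positive for
    distinct points. *)
Lemma annihilator_solution_unique l l' :
  (forall k, A k = 0 -> J l k = 0) -> (forall k, A k = 0 -> J l' k = 0) ->
  A l = y -> A l' = y -> l = l'.
Proof.
move=> Jl Jl' Al Al'; apply/eqP; rewrite -subr_eq0 -normr_eq0; apply/negPn/negP => ne.
have e0 : 0 < `|l - l'| by rewrite lt_neqAle eq_sym ne normr_ge0.
have B0 : 0 < `|l| + 1 by rewrite ltr_wpDl.
have [d d0 Hd] := bregman_lower_bound p1 dJ ucX B0 e0.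
have := Hd l l' ltac:(by rewrite lerDl) (lexx _).
have := bregman_ge0 p1 dJ l' l.
rewrite (bregman_solution Jl Al Al') (bregman_solution Jl' Al' Al).
have := mulr_gt0 d0 e0; lra.
Qed.

End MinimalNormSolution.

Lemma sum_perturb (R : pzRingType) n k (c F : nat -> R) (a : R) : (k < n)%N ->
  \sum_(i < n) (c i + (if i == k :> nat then a else 0)) * F i =
  \sum_(i < n) c i * F i + a * F k.
Proof.
move=> kn; under eq_bigr do rewrite mulrDl.
rewrite big_split /=; congr (_ + _).
rewrite (bigD1 (Ordinal kn))//= eqxx big1 ?addr0// => i.
by rewrite -val_eqE/= => /negbTE ->; rewrite mul0r.
Qed.

(** * Indices of new and kept directions *)

Section DirectionIndices.
Variables (N n : nat).

Lemma Nprev0 : Nprev N 0 = 0%N.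
Proof. by rewrite /Nprev minn0. Qed.

Lemma Nn_last_lt : (0 < N)%N -> ((Nn N n).-1 < Nn N n)%N.
Proof. by rewrite /Nn; lia. Qed.

Lemma Nn0_lt k : (k < Nn N 0)%N -> k = (Nn N 0).-1.
Proof. by rewrite /Nn; lia. Qed.

(** [Nprev N n.+1] equals [Nn N n]. The index shift is 0 while the list grows and 1 once it is full
    and drops its oldest direction. *)
Lemma kept_index_lt k : (k < (Nn N n.+1).-1)%N ->
  (k + Nprev N n.+1 + 1 - Nn N n.+1 < Nn N n)%N.
Proof. by rewrite /Nprev /Nn; lia. Qed.

End DirectionIndices.

(** * Orthogonality and descent along a run *)

Section SesopRun.
Variables (R : realType) (X Y : completeNormedModType R) (p r : R) (N : nat).
Variables (J : X -> X -> R) (JY : Y -> Y -> R) (A : X -> Y) (y : Y) (C : R).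
Variables (x : nat -> X) (wst : nat -> nat -> Y -> R) (s t : nat -> nat -> R).
Hypotheses (p1 : 1 < p) (r1 : 1 < r) (N0 : (0 < N)%N) (ucX : unif_convex X).
Hypotheses (dJ : duality_map p J) (dJY : duality_map r JY).
Hypotheses (lA : islin A) (C0 : 0 < C) (bA : forall z, `|A z| <= C * `|z|).
Hypothesis run : sesop_run p r N J JY A y x wst s t.

Local Notation ps := (p / (p - 1)).
Local Notation D := (bregman p J).
Local Notation res n := (`|A (x n) - y|).
Local Notation running n := (forall m, (m <= n)%N -> res m <> 0).
Local Notation last n := (Nn N n).-1.

Lemma runningW n m : running n -> (m <= n)%N -> running m.
Proof. by move=> ns mn k km; apply: ns; exact: leq_trans mn. Qed.

Lemma precursor_isDual n : running n -> forall k, (k < Nn N n)%N -> isDual (wst n k).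
Proof.
elim: n => [|n IH] ns.
  move=> k /Nn0_lt ->; case: (run ns) => _ [-> _].
  apply: isDual_subsum; first exact: duality_isDual dJY _.
  by move=> i; rewrite Nprev0.
have {}IH := IH (runningW ns (leqnSn n)).
move=> k; rewrite leq_eqVlt => /predU1P[kN|kN].
  have -> : k = last n.+1 by rewrite -kN.
  case: (run ns) => _ [-> _]; apply: isDual_subsum; first exact: duality_isDual dJY _.
  by move=> i iN; exact: IH.
have kN' : (k < last n.+1)%N by rewrite ltn_predRL.
case: (run ns) => _ [_ [keep _]]; rewrite keep//.
exact/IH/kept_index_lt.
Qed.

Lemma direction_isDual n k : running n -> (k < Nn N n)%N -> isDual (fun z => wst n k (A z)).
Proof. by move=> ns kN; exact (isDual_comp lA bA (precursor_isDual ns kN)). Qed.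

Lemma duality_step n z : running n ->
  J (x n.+1) z = J (x n) z - \sum_(k < Nn N n) t n k * wst n k (A z).
Proof. by move=> ns; case: (run ns) => _ [_ [_ [_ ->]]]. Qed.

Lemma step_minimizes n (t' : nat -> R) : running n ->
  ps^-1 * `|x n.+1| `^ p + \sum_(k < Nn N n) t n k * wst n k y <=
  ps^-1 * dnorm (fun z => J (x n) z - \sum_(k < Nn N n) t' k * wst n k (A z)) `^ ps
    + \sum_(k < Nn N n) t' k * wst n k y.
Proof.
move=> ns; rewrite -(dnorm_duality_conj p1 dJ).
by case: (run ns) => _ [_ [_ [H ->]]]; exact: H.
Qed.

(** First-order optimality of [t n]: changing the coefficient [k] by [tau] in either direction
    cannot lower the objective, while [dual_norm_smooth] at [x n.+1] bounds the change by its linear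
    part plus a small error. *)
Lemma step_orthogonal n k : running n -> (k < Nn N n)%N ->
  wst n k (A (x n.+1) - y) = 0.
Proof.
move=> ns kN; set a := wst n k _; pose v z := wst n k (A z).
have dw := precursor_isDual ns kN; have dv : isDual v by exact: direction_isDual.
have aE : a = v (x n.+1) - wst n k y by rewrite /a (dualB dw).
suff H eps : 0 < eps -> `|a| <= eps.
  by apply/eqP; rewrite -normr_le0; apply/ler_addgt0Pr => e /H; rewrite add0r.
move=> eps0; have nv0 := dnorm_ge0 dv; have nv1 : 0 < dnorm v + 1 by rewrite ltr_wpDl.
have B0 : 0 < `|x n.+1| + 1 by rewrite ltr_wpDl.
have e0 : 0 < eps / (dnorm v + 1) by exact: divr_gt0.
have [d d0 Hd] := dual_norm_smooth p1 dJ ucX B0 e0.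
(* Small enough that the perturbation has dual norm at most [d], even when [v] vanishes. *)
pose tau := d / (dnorm v + 1); have tau0 : 0 < tau by exact: divr_gt0.
suff H sg : `|sg| = 1 -> sg * a <= eps.
  rewrite ler_norml lerNl.
  by have := H 1 (normr1 _); have := H (-1) (normrN1 _); rewrite mulN1r mul1r => -> ->.
move=> sg1; pose b := sg * tau.
have nb : `|b| = tau by rewrite normrM sg1 mul1r gtr0_norm.
have nphi : dnorm (fun z => b * v z) <= tau * dnorm v by rewrite -nb; exact: dnormZ.
have := step_minimizes (fun i => t n i + (if i == k then b else 0)) ns.
rewrite (sum_perturb _ (fun i => wst n i y))//.
have -> : (fun z => J (x n) z - \sum_(i < Nn N n)
    (t n i + (if i == k :> nat then b else 0)) * wst n i (A z)) =
    (fun z => J (x n.+1) z - b * v z).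
  apply/funext => z; rewrite (sum_perturb _ (fun i => wst n i (A z)))// duality_step//.
  by rewrite opprD addrA.
have := Hd (x n.+1) _ ltac:(by rewrite lerDl) (isDualZ b dv).
have -> : dnorm (fun z => b * v z) <= d.
  apply: le_trans nphi _; rewrite /tau mulrAC ler_pdivrMr// ler_pM2l//; lra.
move=> /(_ isT) h1 h2.
have : b * a <= eps / (dnorm v + 1) * (tau * dnorm v).
  have := ler_wpM2l (ltW e0) nphi; rewrite aE; lra.
rewrite /b -(mulrA sg) (mulrCA sg) (mulrCA (eps / _)) ler_pM2l// => /le_trans; apply.
by rewrite mulrAC ler_pdivrMr// ler_pM2l//; lra.
Qed.

(** The subtracted precursors annihilate the residual by [step_orthogonal] at the preceding step; at
    step 0 there are none. *)
Lemma new_direction_residual n : running n ->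
  wst n (last n) (A (x n) - y) = res n `^ r.
Proof.
move=> ns; case: (run ns) => _ [-> _]; rewrite (duality_diag dJY).
case: n ns => [|n] ns; first by rewrite Nprev0 big_ord0 subr0.
rewrite big1 ?subr0// => i _.
by rewrite step_orthogonal ?mulr0//; exact: runningW ns (leqnSn n).
Qed.

(** Compares the minimizing coefficients [s n] with zero coefficients. *)
Lemma new_direction_dnorm n : running n ->
  dnorm (fun z => wst n (last n) (A z)) <= C * res n `^ (r - 1).
Proof.
move=> ns; have dv := direction_isDual ns (Nn_last_lt n N0).
have du : isDual (JY (A (x n) - y)) by exact: duality_isDual dJY _.
rewrite -(dnorm_duality dJY).
apply: (@le_trans _ _ (dnorm (fun z => JY (A (x n) - y) (A z)))); last first.
  exact (dnorm_comp (ltW C0) bA du).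
have dv0 := dnorm_ge0 dv.
case: (run ns) => /(_ (fun=> 0)) + [wE _].
have -> : (fun z => JY (A (x n) - y) (A z) - \sum_(i < Nprev N n) s n i * wst n.-1 i (A z))
  = (fun z => wst n (last n) (A z)) by rewrite wE.
have -> : (fun z => JY (A (x n) - y) (A z) - \sum_(i < Nprev N n) 0 * wst n.-1 i (A z))
  = (fun z => JY (A (x n) - y) (A z)).
  by apply/funext => z; rewrite big1 ?subr0// => i _; rewrite mul0r.
rewrite leNgt [_ <= _]leNgt; apply: contraNN => lt.
have du' := isDual_comp lA bA du.
by apply: (gt0_ltr_powR (conjugate_gt0 p1)); rewrite ?nnegrE ?dnorm_ge0.
Qed.

(** Since [A z = y], the step objective at [t n] differs from [D (x n.+1) z] by terms free of
    [t n]. *)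
Lemma bregman_step n z (t' : nat -> R) : running n -> A z = y ->
  D (x n.+1) z <=
  ps^-1 * dnorm (fun z => J (x n) z - \sum_(k < Nn N n) t' k * wst n k (A z)) `^ ps
    + \sum_(k < Nn N n) t' k * wst n k y - J (x n) z + p^-1 * `|z| `^ p.
Proof.
move=> ns Az; have := step_minimizes t' ns.
rewrite /bregman duality_step// Az; lra.
Qed.

Lemma bregman_step_le n z : running n -> A z = y -> D (x n.+1) z <= D (x n) z.
Proof.
move=> ns Az; apply: le_trans (bregman_step (fun=> 0) ns Az) _.
have -> : (fun z => J (x n) z - \sum_(k < Nn N n) 0 * wst n k (A z)) = J (x n).
  by apply/funext => v; rewrite big1 ?subr0// => i _; rewrite mul0r.
rewrite (dnorm_duality_conj p1 dJ) big1 ?addr0// => i _; rewrite mul0r//.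
Qed.

Lemma bregman_descent B eps : 0 < B -> 0 < eps -> exists2 d, 0 < d &
  forall n z, running n -> A z = y -> `|x n| <= B ->
    D (x n.+1) z <= D (x n) z - d * (res n / C - eps).
Proof.
move=> B0 e0; have [d d0 Hd] := dual_norm_smooth p1 dJ ucX B0 e0.
exists d => // n z ns Az xB.
have R0 : 0 < res n by rewrite lt_neqAle normr_ge0 andbT eq_sym; apply/eqP/ns.
have Rr0 : 0 < res n `^ (r - 1) by exact: powR_gt0.
pose k := last n; have kN : (k < Nn N n)%N := Nn_last_lt n N0.
pose v z := wst n k (A z); have dv : isDual v by exact: direction_isDual.
(* The competitor moves along the newest direction alone, by the step for which its norm bound
   yields [d]; the linear gain is then [d * (res n / C)]. *)
pose tau := d / (C * res n `^ (r - 1)).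
have tau0 : 0 < tau by rewrite divr_gt0// mulr_gt0.
have nphi : dnorm (fun z => tau * v z) <= d.
  apply: le_trans (dnormZ _ dv) _; rewrite gtr0_norm//.
  have := ler_wpM2l (ltW tau0) (new_direction_dnorm ns).
  by rewrite /tau divfK// gt_eqF// mulr_gt0.
have := bregman_step (fun i => 0 + (if i == k then tau else 0)) ns Az.
have sumE (F : nat -> R) :
    \sum_(i < Nn N n) (0 + (if i == k :> nat then tau else 0)) * F (nat_of_ord i)
    = tau * F k.
  rewrite -[RHS]add0r; apply: etrans (sum_perturb (fun=> 0) F tau kN) _.
  by rewrite big1// => i _; rewrite mul0r.
rewrite (sumE (fun i => wst n i y)).
have -> : (fun z => J (x n) z - \sum_(i < Nn N n)
    (0 + (if i == k :> nat then tau else 0)) * wst n i (A z)) =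
    (fun z => J (x n) z - tau * v z).
  by apply/funext => u; rewrite (sumE (fun i => wst n i (A u))).
have h1 := Hd (x n) _ xB (isDualZ tau dv) nphi.
have h2 := ler_wpM2l (ltW e0) nphi.
have h3 : tau * v (x n) - tau * wst n k y = d * (res n / C).
  rewrite -mulrBr -(dualB (precursor_isDual ns kN)) new_direction_residual//.
  rewrite -(mulr_powRB1 (normr_ge0 _) (p_gt0 r1)) /tau.
  by field; rewrite !gt_eqF.
rewrite /bregman; lra.
Qed.

(** Every update subtracts functionals that factor through [A]. The strict bound [m < n] covers the
    stopping index too. *)
Lemma duality_kernel n z : (forall m, (m < n)%N -> res m <> 0) -> A z = 0 ->
  J (x n) z = J (x 0%N) z.
Proof.
move=> + Az; elim: n => [//|n IH] ns.
have rn : running n by move=> m mn; exact: ns.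
rewrite duality_step// big1 => [|i _].
  by rewrite subr0; apply: IH => m mn; apply: ns; exact: ltnW.
by rewrite Az (dual0 (precursor_isDual rn (ltn_ord i))) mulr0.
Qed.

(** * Limits of a run that never stops *)

Section NonStopping.
Hypothesis never : forall n, res n <> 0.
Variable z0 : X.
Hypothesis Az0 : A z0 = y.

Lemma iterates_bounded : exists2 B, 0 < B & forall n, `|x n| <= B.
Proof.
have [B B0 HB] := bregman_coercive p1 dJ (D (x 0%N) z0) `|z0|.
exists B => // n; apply: (HB _ z0) => //.
elim: n => [//|n IH]; apply: le_trans IH.
by apply: bregman_step_le => // m _; exact: never.
Qed.

Lemma residual_cvg0 : (fun n => res n) @ \oo --> (0 : R).
Proof.
have [B B0 xB] := iterates_bounded.
pose Dn n := D (x n) z0.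
have Dni : nonincreasing_seq Dn.
  by apply/nonincreasing_seqP => n; apply: bregman_step_le => // m _; exact: never.
have Dcvg : cvgn Dn.
  apply: nonincreasing_is_cvgn => //; exists 0 => _ [n _ <-]; exact: bregman_ge0.
have /cvg_seqP HD := Dcvg.
apply/cvg_seqP => e e0.
(* Half of [e / C] is the error of the descent estimate; the other half bounds the eventual decrease
   of [Dn], divided by [d]. *)
have eps0 : 0 < e / (2 * C) by rewrite divr_gt0// mulr_gt0.
have [d d0 Hd] := bregman_descent B0 eps0.
have [M HM] := HD (d * (e / (2 * C)) / 2) ltac:(by rewrite divr_gt0// mulr_gt0).
exists M => n Mn; rewrite subr0 normr_id.
have := Hd n z0 (fun m _ => @never m) Az0 (xB n); rewrite -/(Dn n) -/(Dn n.+1) => h1.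
have := HM _ Mn; have := HM _ (leqW Mn); rewrite !ltr_norml => /andP[h2 h3] /andP[h4 h5].
have : d * (res n / C - e / (2 * C)) < d * (e / (2 * C)) by lra.
rewrite ltr_pM2l// ltrBlDr.
have -> : e / (2 * C) + e / (2 * C) = e / C by field; rewrite gt_eqF.
by rewrite ltr_pM2r// invr_gt0.
Qed.

Hypothesis weakJ : forall (u : nat -> X) (l : X), weak_cvg u l ->
  weak_cvg_dual (fun n => J (u n)) (J l).
Hypothesis annih0 : forall z, A z = 0 -> J (x 0%N) z = 0.

Lemma subsequence_limit (f : nat -> nat) : (forall k, (k <= f k)%N) ->
  exists l m, [/\ forall k, (k <= m k)%N, weak_cvg (x \o f \o m) l, A l = y &
    forall z, A z = 0 -> J l z = 0].
Proof.
move=> fk; have [B B0 xB] := iterates_bounded.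
have [l [m [mk wl]]] := bounded_weak_subsequence ucX p1 dJ (fun n => xB (f n)).
exists l, m; split=> // [|z Az].
  (* Pairing the residual vectors with [JY w] gives the limit 0, as their norms vanish, and the
     limit [JY w w], by weak convergence; hence [w = 0]. *)
  set w := A l - y; have dw : isDual (JY w) by exact: duality_isDual dJY _.
  have : (fun n => JY w (A (x (f (m n))) - y)) @ \oo --> (0 : R).
    apply/cvg_seqP => e e0; have nw0 := dnorm_ge0 dw.
    have nw1 : 0 < dnorm (JY w) + 1 by rewrite ltr_wpDl.
    have /cvg_seqP/(_ (e / (dnorm (JY w) + 1)) (divr_gt0 e0 nw1))[K HK] := residual_cvg0.
    exists K => n Kn; rewrite subr0; apply: le_lt_trans (dnormP _ dw) _.
    have := HK (f (m n)) (leq_trans Kn (leq_trans (mk n) (fk _))).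
    rewrite subr0 normr_id ltr_pdivlMr// => h; have := normr_ge0 (A (x (f (m n))) - y); lra.
  have : (fun n => JY w (A (x (f (m n))) - y)) @ \oo --> JY w w.
    have /wl/cvg_seqP H := isDual_comp lA bA dw.
    apply/cvg_seqP => e /H[K HK]; exists K => n /HK /=.
    rewrite [JY w w](dualB dw) [JY w (_ - y)](dualB dw).
    by rewrite opprB addrA subrK.
  move=> h1 h2; have h3 := cvg_seq_unique h2 h1.
  rewrite (duality_diag dJY) in h3.
  by apply/eqP; rewrite -subr_eq0 -normr_eq0; apply/eqP; exact: powR_eq0_eq0 (esym h3).
have h1 := weakJ wl (evaluation_isBidual z).
have h2 : (fun n => J ((x \o f \o m) n) z) @ \oo --> (0 : R).
  have -> : (fun n => J ((x \o f \o m) n) z) = (fun=> 0); last exact: cvg_cst.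
  apply/funext => n /=; rewrite duality_kernel ?annih0// => k _; exact: never.
exact: cvg_seq_unique h1 h2.
Qed.

(** If some [g] failed to converge, a subsequence staying [e] away from [g l] would itself have a
    weak cluster point, which uniqueness identifies with [l]. *)
Lemma iterates_weak_cvg : exists l,
  [/\ weak_cvg x l, A l = y & forall z, A z = 0 -> J l z = 0].
Proof.
have [l [_ [_ _ Al Jl]]] := subsequence_limit (fun k => leqnn k).
exists l; split=> // g dg; apply/cvg_seqP => e e0; apply: contrapT => Hn.
have /choice[f Hf] : forall k, exists n, (k <= n)%N /\ e <= `|g (x n) - g l|.
  move=> k; apply: contrapT => Hk; apply: Hn; exists k => n kn.
  by rewrite ltNge; apply/negP => le; apply: Hk; exists n.
have [l' [m [mk wl Al' Jl']]] := subsequence_limit (fun k => proj1 (Hf k)).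
have ll := annihilator_solution_unique p1 ucX dJ lA Jl Jl' Al Al'.
have /cvg_seqP/(_ e e0)[K /(_ K (leqnn K))] := wl g dg.
by rewrite -ll /= ltNge; have [_ ->] := Hf (m K).
Qed.

End NonStopping.
End SesopRun.

(** * Finite termination or weak convergence to the projection *)

Theorem mainTheorem1 (R : realType) (X Y : completeNormedModType R)
  (p r : R) (N : nat) (Jp : X -> X -> R) (JrY : Y -> Y -> R)
  (A : X -> Y) (y : Y)
  (x : nat -> X) (wst : nat -> nat -> Y -> R) (s t : nat -> nat -> R) :
  1 < p -> 1 < r -> (0 < N)%N ->
  smooth_space X -> unif_convex X ->
  duality_map p Jp ->
  (forall (u : nat -> X) (l : X), weak_cvg u l -> weak_cvg_dual (fun n => Jp (u n)) (Jp l)) ->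
  duality_map r JrY ->
  islin A -> (exists C : R, forall z : X, `|A z| <= C * `|z|) ->
  (exists z : X, A z = y) ->
  (forall eps : R, 0 < eps -> exists w : Y -> R, isDual w /\
     dnorm (fun z => Jp (x 0%N) z - w (A z)) < eps) ->
  sesop_run p r N Jp JrY A y x wst s t ->
  let M := [set z : X | A z = y] in
  (exists n : nat, `|A (x n) - y| = 0 /\ (forall m, (m < n)%N -> `|A (x m) - y| <> 0) /\
     is_bregman_proj p Jp M (x 0%N) (x n)) \/
  ((forall n : nat, `|A (x n) - y| <> 0) /\
   exists z : X, is_bregman_proj p Jp M (x 0%N) z /\ weak_cvg x z).
Proof.
move=> p1 r1 N0 _ ucX dJ weakJ dJY lA [C0 bA0] [z0 Az0] range0 run M.
pose C := `|C0| + 1.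
have Cgt0 : 0 < C by rewrite ltr_wpDl.
have bA z : `|A z| <= C * `|z|.
  apply: le_trans (bA0 z) _; apply: ler_wpM2r => //.
  by apply: le_trans (ler_norm C0) _; rewrite lerDl.
(* Functionals of the form [w] after [A] vanish on the kernel of [A], and [Jp (x 0)] is a norm limit
   of such functionals. *)
have annih0 z : A z = 0 -> Jp (x 0%N) z = 0.
  move=> Az; apply/eqP; rewrite -normr_le0; apply/ler_addgt0Pr => e e0.
  rewrite add0r; have nz1 : 0 < `|z| + 1 by rewrite ltr_wpDl.
  have [w [dw wle]] := range0 (e / (`|z| + 1)) (divr_gt0 e0 nz1).
  have dwA := isDual_comp lA bA dw.
  have := dnormP z (isDual_sub (duality_isDual dJ (x 0%N)) dwA).
  rewrite Az (dual0 dw) subr0 => /le_trans; apply.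
  have := ler_wpM2r (normr_ge0 z) (ltW wle).
  move=> /le_trans; apply.
  by rewrite mulrAC ler_pdivrMr// ler_pM2l// lerDl.
have [[n stop]|never] := pselect (exists n, `|A (x n) - y| = 0); [left|right].
  have ex : exists n, `|A (x n) - y| == 0 by exists n; apply/eqP.
  (* The least stopping index is taken, so the run constraints hold at all earlier steps. *)
  case: (ex_minnP ex) => k /eqP rk kmin.
  have before m : (m < k)%N -> `|A (x m) - y| <> 0.
    by move=> mk /eqP/kmin; rewrite leqNgt mk.
  exists k; split=> //; split=> //.
  apply: (annihilator_is_bregman_proj p1 dJ lA annih0).
    move=> z Az.
    by rewrite (duality_kernel dJY run before Az) annih0.
  by apply/eqP; rewrite -subr_eq0 -normr_eq0 rk.
have {}never n : `|A (x n) - y| <> 0 by move=> h; apply: never; exists n.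
split=> //.
have [l [wl Al Jl]] := iterates_weak_cvg p1 r1 N0 ucX dJ dJY lA Cgt0 bA run never
  Az0 weakJ annih0.
exists l; split=> //; exact (annihilator_is_bregman_proj p1 dJ lA annih0 Jl Al).
Qed.
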